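(* Any $d$-dimensional normed space has a separating family of $\mathrm{O}(5^{d+\mathrm{o}(d)})$ thin cones.
   Context: All normed spaces are real. Let $X$ be a normed space with unit sphere $\partial B_X=\{x:\|x\|=1\}$ and origin $o$. A subset $P\subseteq X$ is a convex cone if $x+y\in P$ and $\lambda x\in P$ whenever $x,y\in P$ and $\lambda\geq 0$ (cones are non-empty and need not be closed); it is proper if $P\cap(-P)=\{o\}$. A proper convex cone $P$ in $X$ is thin if $\bigl((P\cap\partial B_X)-(P\cap\partial B_X)\bigr)\cap P=\{o\}$, equivalently, $a-b\notin P$ for any distinct $a,b\in P\cap\partial B_X$. A family $\mathcal{P}$ of proper convex cones in $X$ is separating if $\bigcup_{P\in\mathcal{P}}(P\cup(-P))=X$. The asymptotic bound is as $d\to\infty$, with implied constant and $\mathrm{o}(d)$ term independent of the normed space. *)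

(* Defs.v *)
From HB Require Import structures.
From mathcomp Require Export all_boot all_order all_algebra.
From mathcomp Require Export all_classical all_reals all_analysis.

Set Implicit Arguments.
Unset Strict Implicit.
Unset Printing Implicit Defensive.

Export Order.TTheory GRing.Theory Num.Theory.
Export numFieldNormedType.Exports.

Local Open Scope classical_set_scope.
Local Open Scope ring_scope.

Section Cones.
Context {R : realType} {X : lmodType R}.
Implicit Types (P : set X) (F : set (set X)).

Definition convex_cone P : Prop :=
  [/\ P !=set0,
      forall x y, P x -> P y -> P (x + y)
    & forall (l : R) x, 0 <= l -> P x -> P (l *: x)].

Definition proper_cone P : Prop :=
  convex_cone P /\ P `&` [set - x | x in P] = [set 0].

Definition separating F : Prop :=
  F `<=` proper_cone /\
  \bigcup_(P in F) (P `|` [set - x | x in P]) = [set: X].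

End Cones.

Section Thin.
Context {R : realType} {X : normedModType R}.

Definition unit_sphere : set X := [set x | `|x| = 1].

(* With an equality to [set 0], rather than an inclusion in it, the trivial
   cone [set 0] is not thin: it does not meet the unit sphere.  Every nontrivial
   proper cone contains a unit vector, so for these the two readings agree. *)
Definition thin (P : set X) : Prop :=
  proper_cone P /\
  [set a - b | a in P `&` unit_sphere & b in P `&` unit_sphere] `&` P = [set 0].

End Thin.

(* Main.v *)
From HB Require Import structures.
From mathcomp Require Import zify ring lra.
Require Import Defs.

Set Implicit Arguments.
Unset Strict Implicit.
Unset Printing Implicit Defensive.

Local Open Scope classical_set_scope.
Local Open Scope card_scope.
Local Open Scope ring_scope.

(** If r < 1/4 and the ball B(c, r) meets the unit sphere, then |c| > 3 r and the
    cone generated by B(c, r) is thin.  It therefore suffices to cover the sphere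
    by 5 ^ (d + o(d)) balls of some radius r < 1/4.

    Volumes are replaced by numbers g(s) of points of norm at most s in a
    lattice of rank d.  Since g(s) = O(s ^ d), for every l > 1 there are
    arbitrarily large s with g(l s) <= 2 l ^ d g(s); with l close to
    (1 + 1/4) / (1/4) = 5, each lattice point of the (slightly enlarged) ball of
    radius t (about 4 s) lies in a fraction at least 1 / (4 * 5 ^ d) of the balls of
    radius s centred at lattice points of norm at most 5/4 t.  Choosing
    centres greedily, a polynomial number of times 5 ^ d of them leaves fewer
    points uncovered than a ball of radius delta t contains, where
    delta = 1 / (24 d); so every point of the ball is within delta t of a covered
    one. *)

(** * Cones generated by balls *)

(* For l > 0 the condition says that x / l lies in the ball B(c, r), and for
   l = 0 that x = 0. *)
Definition ball_cone {R : realType} {X : normedModType R} (r : R) (c : X) :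
  set X := [set x | exists2 l, 0 <= l & `|x - l *: c| <= l * r].

(** If x and -x both lie in the cone, adding the two bounds gives (l + m) |c| <= (l + m) r, so r <
    |c| forces l = 0 and hence x = 0. *)
Lemma ball_cone_proper {R : realType} {X : normedModType R} (r : R) (c : X) :
  0 <= r -> r < `|c| -> proper_cone (ball_cone r c).
Proof.
move=> r0 rc; split.
  split.
  - by exists 0, 0 => //; rewrite scale0r subr0 normr0 mul0r.
  - move=> x y [l l0 xl] [m m0 ym]; exists (l + m); first exact: addr_ge0.
    rewrite scalerDl opprD addrACA mulrDl.
    exact: le_trans (ler_normD _ _) (lerD xl ym).
  - move=> k x k0 [l l0 xl]; exists (k * l); first exact: mulr_ge0.
    by rewrite -scalerA -scalerBr normrZ ger0_norm// -mulrA ler_wpM2l.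
apply/seteqP; split=> x /=; last first.
  have P0 : ball_cone r c 0.
    by exists 0 => //; rewrite scale0r subr0 normr0 mul0r.
  by move=> ->; split=> //; exists 0; rewrite ?oppr0.
move=> [[l l0 xl] [y [m m0 ym] yx]].
have yE : y = - x by rewrite -yx opprK.
have : `|(l + m) *: c| <= (l + m) * r.
  rewrite (_ : _ *: c = - ((x - l *: c) + (- x - m *: c))).
    rewrite normrN mulrDl; apply: le_trans (ler_normD _ _) (lerD xl _).
    by rewrite -yE.
  by rewrite addrACA subrr add0r opprD !opprK scalerDl.
rewrite normrZ ger0_norm ?addr_ge0// => h.
have l00 : l = 0 by apply/eqP; rewrite eq_le l0 andbT; nra.
by move: xl; rewrite l00 scale0r subr0 mul0r normr_le0 => /eqP.
Qed.

(** Suppose that a, b are unit vectors of the cone and that a - b lies in it with multiplier m > 0.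
    If l is the multiplier of b, then b - (l / m) (a - b) has norm at most 2 l r < l (|c| - r) <= 1,
    against the convexity of the norm. *)
Lemma ball_cone_thin {R : realType} {X : normedModType R} (r : R) (c : X) :
  0 <= r -> 3 * r < `|c| -> thin (ball_cone r c).
Proof.
move=> r0 rc; have rc' : r < `|c| by lra.
have c0 : 0 < `|c| by lra.
split; first exact: ball_cone_proper.
apply/seteqP; split=> x /=; last first.
  move=> ->; split; last by exists 0; rewrite // scale0r subr0 normr0 mul0r.
  have cS : (ball_cone r c `&` unit_sphere) (`|c|^-1 *: c).
    split; rewrite /unit_sphere/=.
      by exists `|c|^-1; rewrite ?subrr ?normr0 ?mulr_ge0 ?invr_ge0.
    by rewrite normrZ ger0_norm ?invr_ge0// mulVf// gt_eqF.
  by exists (`|c|^-1 *: c) => //; exists (`|c|^-1 *: c) => //; rewrite subrr.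
move=> [[a [_ a1] [b [[l l0 bl] b1] <-]] [m m0 pm]].
rewrite /unit_sphere/= in a1 b1.
apply/eqP; case: (ltgtP m 0) m0 => // [m0 _|m0 _]; last first.
  by move: pm; rewrite m0 scale0r subr0 mul0r normr_le0.
have lc : l * (`|c| - r) <= 1.
  rewrite mulrBr lerBlDr -b1 -[X in X * `|c|](ger0_norm l0) -normrZ.
  rewrite -[X in `|X| <= _](subrKC b) (le_trans (ler_normD _ _))// lerD2l.
  by rewrite distrC.
have lp : 0 < l.
  rewrite lt_neqAle l0 andbT eq_sym; apply: contraPneq bl => ->.
  by rewrite scale0r subr0 mul0r b1 ler10.
pose s := l / m; have s0 : 0 <= s by rewrite divr_ge0// ltW.
have sm : s * m = l by rewrite /s divfK// gt_eqF.
(* The norm is convex along the line through b and a = b + p, so it cannot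
   drop below 1 before b. *)
have bsp : `|b - s *: (a - b)| <= 2 * l * r.
  rewrite (_ : b - _ = (b - l *: c) - s *: (a - b - m *: c)).
    rewrite (le_trans (ler_normB _ _))// normrZ ger0_norm//.
    have := ler_wpM2l s0 pm; rewrite mulrA sm; lra.
  by rewrite [in RHS]scalerBr scalerA sm opprB addrA subrK.
have : `|(1 + s) *: b| <= s + `|b - s *: (a - b)|.
  rewrite (_ : (1 + s) *: b = s *: a + (b - s *: (a - b))).
    rewrite (le_trans (ler_normD _ _))// normrZ ger0_norm// a1; lra.
  by rewrite scalerBr opprB scalerDl scale1r addrCA subrKC.
rewrite normrZ b1 ger0_norm; last by lra.
by nra.
Qed.

(** * Greedy covering of a finite set *)

(** Double counting: the uncovered part U has at least k |U| incidences with at most q k centres, so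
    some centre covers at least |U| / q of its points. *)
Lemma greedy_cover (T S : eqType) (e : T -> S -> bool) (C : seq S) (Y : seq T)
    (q k : nat) :
  (0 < k)%N -> (size C <= q * k)%N ->
  {in Y, forall y, (k <= count (e y) C)%N} ->
  forall n, exists2 W : seq S, (size W <= n)%N &
    (q ^ n * count (fun y => ~~ has (e y) W) Y <= q.-1 ^ n * size Y)%N.
Proof.
move=> k0 Cqk Yk; elim=> [|n [W Wn IH]].
  by exists [::]; rewrite // !expn0 !mul1n count_size.
pose U := [seq y <- Y | ~~ has (e y) W].
have UE : size U = count (fun y => ~~ has (e y) W) Y by rewrite size_filter.
have [U0|U0] := posnP (size U).
  by exists W; rewrite ?leqW// -UE U0 muln0.
have [w wU] : exists w, (size U <= q * count (e^~ w) U)%N.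
  have dc : (\sum_(w <- C) count (e^~ w) U = \sum_(y <- U) count (e y) C)%N.
    under eq_bigr do rewrite -sum1_count big_mkcond.
    under [RHS]eq_bigr do rewrite -sum1_count big_mkcond.
    exact: exchange_big.
  have Uk : (size U * k <= \sum_(y <- U) count (e y) C)%N.
    rewrite -sum1_size big_distrl /= big_seq [leqRHS]big_seq.
    by apply: leq_sum => y; rewrite mem_filter mul1n => /andP[_ /Yk].
  apply: contrapT => /forallNP noW.
  have : (\sum_(w <- C) (1 + q * count (e^~ w) U) <= size C * size U)%N.
    rewrite -(sum1_size C) big_distrl /=; apply: leq_sum => w _.
    by rewrite mul1n ltnNge; apply/negP/noW.
  rewrite big_split /= sum1_size -big_distrr /= dc.
  have C0 : (0 < size C)%N.
    by case: C dc Uk {Cqk Yk noW} => // dc; rewrite -dc big_nil; nia.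
  nia.
exists (w :: W) => //.
have -> : count (fun y => ~~ has (e y) (w :: W)) Y = count (predC (e^~ w)) U.
  by rewrite count_filter; apply: eq_count => y /=; rewrite negb_or.
have := count_predC (e^~ w) U; rewrite -UE in IH.
rewrite !expnS.
move: (count _ U) (count _ U) wU IH => a b wU IH ab.
nia.
Qed.

(** * Counting and growth of lattice points *)

Lemma finite_int_box (d : nat) (M : nat) :
  finite_set [set z : 'rV[int]_d | forall i, (`|z 0%R i| <= M)%N].
Proof.
pose f (g : {ffun 'I_d -> 'I_(M + M).+1}) : 'rV[int]_d :=
  \row_i ((g i)%:Z - M%:Z).
apply: (@sub_finite_set _ _ (range f)); last exact/finite_image/finite_finset.
move=> z /= zM; exists [ffun i => inord (absz (z 0 i + M%:Z))] => //.
apply/rowP => i; rewrite mxE ffunE inordK; have := zM i; lia.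
Qed.

(* Lattice points of a ball of radius a that agree modulo m
   differ by m times a lattice point of norm at most 2a/m. *)
Lemma scale_lattice_count (R : realType) (X : normedModType R) (d : nat)
    (f : {additive 'rV[int]_d -> X}) (m : nat) (a b : R) (A B : seq 'rV[int]_d) :
  (0 < m)%N -> uniq A ->
  (forall z, z \in A -> `|f z| <= a) -> (forall z, `|f z| <= b -> z \in B) ->
  2 * a <= m%:R * b -> (size A <= m ^ d * size B)%N.
Proof.
case: m => // m _ uA Aa Bb ab.
pose res (z : 'rV[int]_d) : 'rV['I_m.+1]_d :=
  \row_i inord (absz (z 0%R i %% m.+1%:Z)%Z).
rewrite -sum1_size (partition_big res xpredT)//=.
apply: (@leq_trans (\sum_(j : 'rV['I_m.+1]_d) size B)%N); last first.
  by rewrite sum_nat_const card_mx card_ord mul1n.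
apply: leq_sum => j _; rewrite sum1_count -size_filter.
have fibP z : (z \in [seq x <- A | res x == j]) = (res z == j) && (z \in A).
  by rewrite mem_filter.
have uF : uniq [seq x <- A | res x == j] by rewrite filter_uniq.
case: [seq x <- A | res x == j] fibP uF => // z0 s fibP uF.
have := fibP z0; rewrite mem_head => /esym/andP[/eqP z0j z0A].
(* Based at its element [z0], a residue class injects into [B] by division of z - z0 by m. *)
pose g (z : 'rV[int]_d) : 'rV[int]_d := \row_i ((z 0%R i - z0 0%R i) %/ m.+1%:Z)%Z.
have gK z : z \in z0 :: s -> z = z0 + g z *+ m.+1.
  rewrite fibP => /andP[/eqP zj _]; apply/rowP => i.
  have /rowP/(_ i) : res z = res z0 by rewrite zj z0j.
  rewrite !mxE => /(congr1 val) /=.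
  rewrite !inordK; try lia.
  move=> h; have {}h : (z 0%R i = z0 0%R i %[mod m.+1%:Z])%Z by lia.
  rewrite mulmxnE mxE -mulr_natr natz divzK ?subrKC//.
  by rewrite -eqz_mod_dvd; apply/eqP.
rewrite -(size_map g); apply: uniq_leq_size.
  rewrite map_inj_in_uniq// => x y /gK xE /gK yE gxy.
  by rewrite xE yE gxy.
move=> _ /mapP[z zs ->]; apply: Bb.
rewrite -(@ler_pM2l _ m.+1%:R)// (le_trans _ ab)//.
rewrite -[X in X * `|_|]normr_nat -normrZ scaler_nat -raddfMn.
rewrite (_ : g z *+ _ = z - z0); last by rewrite {2}(gK _ zs) addrC addKr.
rewrite raddfB (le_trans (ler_normB _ _))// mulr2n mulrDl mul1r.
move: zs; rewrite fibP => /andP[_ zA].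
by rewrite lerD// Aa.
Qed.

(** If every s failed, iterating along l ^ k s0 would make g grow by a factor of at least 2 ^ k (l ^
    k) ^ d; the surplus 2 ^ k contradicts the bound K s ^ d. *)
Lemma geometric_growth (R : realType) (g : R -> R) (l s0 K : R) (d : nat) :
  1 < l -> 0 < s0 -> 0 < g s0 ->
  (forall s, s0 <= s -> g s <= K * s ^+ d) ->
  exists2 s, s0 <= s & g (l * s) <= 2 * l ^+ d * g s.
Proof.
move=> l1 s00 gs0 gK; apply: contrapT => /forall2NP noS.
have ls k : s0 <= l ^+ k * s0.
  by apply: ler_peMl; [exact: ltW|exact/exprn_ege1/ltW].
have grow k : 2 ^+ k * (l ^+ k) ^+ d * g s0 <= g (l ^+ k * s0).
  elim: k => [|k IH]; first by rewrite !expr0 expr1n !mul1r.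
  have [|/negP] := noS (l ^+ k * s0); first by rewrite ls.
  rewrite -ltNge mulrA -exprS => /ltW; apply: le_trans.
  rewrite [in leLHS]exprS [l ^+ k.+1]exprS exprMn -!mulrA ler_pM2l//.
  rewrite [leLHS]mulrCA ler_wpM2l ?exprn_ge0//; first lra.
  by rewrite mulrA.
have bnd k : 2 ^+ k * g s0 <= K * s0 ^+ d.
  have := le_trans (grow k) (gK _ (ls k)).
  rewrite exprMn [leLHS]mulrAC [leRHS]mulrCA [leRHS]mulrC ler_pM2r//.
  by rewrite !exprn_gt0// (lt_trans _ l1).
have := bnd (Num.truncn (K * s0 ^+ d / g s0)).+1.
rewrite -ler_pdivlMr// leNgt => /negP; apply.
rewrite (lt_le_trans (truncnS_gt _))// -natrX ler_nat ltnW// ltn_expl//.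
Qed.

(** * Numerical estimates *)

Lemma bernoulli_ge (R : realFieldType) (x : R) (n : nat) :
  0 <= x <= 1 -> 1 - x * n%:R <= (1 - x) ^+ n.
Proof.
move=> /andP[x0 x1]; elim: n => [|n IH]; first by rewrite mulr0 subr0 expr0.
rewrite exprS -natr1; have : 0 <= n%:R :> R by []; nra.
Qed.

(** Bernoulli's inequality (1 + 1 / p) ^ k >= 1 + k / p, at p = q - 1 and k = q, gives a value of at
    least 2. *)
Lemma double_predn_exp (q : nat) : (1 < q)%N -> (2 * q.-1 ^ q <= q ^ q)%N.
Proof.
case: q => [|p] // p0; rewrite /= ltnS in p0 *.
have bern k : (p ^ k * (p + k) <= p * p.+1 ^ k)%N.
  elim: k => [|k IH]; first by rewrite addn0 !expn0 mul1n muln1.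
  rewrite !expnS; move: (p ^ k)%N (p.+1 ^ k)%N IH => a b IH; nia.
have := bern p.+1; move: (p ^ _)%N (p.+1 ^ _)%N => a b; nia.
Qed.

(* Every 4 * 5 ^ d greedy steps halve the uncovered part, and (52 * d) ^ d bounds
   the ratio of the numbers of lattice points in balls of radius (1 + 2 delta) t
   and delta t, as 52 * d >= 2 (1 + 2 delta) / delta for delta = 1 / (24 d). *)
Lemma greedy_steps (d : nat) (q := (4 * 5 ^ d)%N) (n := (q * (52 * d * d))%N) :
  (0 < d)%N -> (q.-1 ^ n * (52 * d) ^ d < q ^ n)%N.
Proof.
move=> d0; have q1 : (1 < q)%N by rewrite /q; have := expn_gt0 5 d; lia.
rewrite /n !(expnM _ q).
apply: (@leq_trans ((2 * q.-1 ^ q) ^ (52 * d * d))); last first.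
  by rewrite leq_exp2r ?double_predn_exp// !muln_gt0 d0.
(* The [52 * d * d] halvings suffice because 2 ^ (52 d) > 52 d. *)
rewrite [ltnRHS]expnMn mulnC ltn_pmul2r; last by rewrite !expn_gt0; lia.
by rewrite expnM ltn_exp2r// ltn_expl.
Qed.

(** * From lattice points to a cover of the sphere *)

Lemma lattice_balls (R : realType) (X : normedModType R) (d : nat)
    (f : {additive 'rV[int]_d -> X}) (C : R) :
  0 < C -> (forall (z : 'rV[int]_d) i, `|z 0 i|%:~R <= C * `|f z|) ->
  exists2 E : R -> seq 'rV[int]_d, forall s, uniq (E s) &
    forall s z, (z \in E s) = (`|f z| <= s).
Proof.
move=> C0 fC.
have fin s : finite_set [set z | `|f z| <= s].
  apply: sub_finite_set (finite_int_box d (Num.truncn (C * s)).+1).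
  move=> z /= zs i; rewrite -(ler_nat R) (le_trans _ (ltW (truncnS_gt _)))//.
  by rewrite natr_absz (le_trans (fC _ _))// ler_pM2l.
exists (fun s => finmap.enum_fset (fset_set [set z | `|f z| <= s])) => [s|s z].
  exact: finmap.fset_uniq.
have -> := in_fset_set (fin s) z.
by apply/idP/idP => [/set_mem|/mem_set].
Qed.

(** The ball of radius 1 / (2 C) contains only 0, as coordinates there are below 1 in absolute
    value. Comparison with it at a scale m > 4 C s costs a factor m ^ d, and m <= (4 C + 1) s. *)
Lemma size_lattice_ball_le (R : realType) (X : normedModType R) (d : nat)
    (f : {additive 'rV[int]_d -> X}) (C : R) (E : R -> seq 'rV[int]_d) :
  0 < C -> (forall (z : 'rV[int]_d) i, `|z 0 i|%:~R <= C * `|f z|) ->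
  (forall s, uniq (E s)) -> (forall s z, (z \in E s) = (`|f z| <= s)) ->
  forall s, 1 <= s -> (size (E s))%:R <= (4 * C + 1) ^+ d * s ^+ d.
Proof.
move=> C0 fC uE EP s s1; pose b := (2 * C)^-1.
have b0 : 0 < b by rewrite invr_gt0; lra.
have Eb : (size (E b) <= 1)%N.
  apply: (@uniq_leq_size _ _ [:: 0]) => // z; rewrite EP mem_seq1 => zb.
  apply/eqP/rowP => i; rewrite mxE; apply/eqP.
  suff : `|z 0%R i| < 1 by lia.
  rewrite -(ltr_int R).
  rewrite (le_lt_trans (fC _ _))// (le_lt_trans (ler_wpM2l (ltW C0) zb))//.
  by rewrite /b invfM mulrCA divff ?gt_eqF// mulr1; lra.
pose m := (Num.truncn (4 * C * s)).+1.
have m1 : 4 * C * s < m%:R by exact: truncnS_gt.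
have m2 : m%:R <= 4 * C * s + 1.
  rewrite /m -natr1 lerD2r truncn_le; nra.
have : (size (E s) <= m ^ d * size (E b))%N.
  apply: (scale_lattice_count (f := f) (a := s) (b := b)) => //.
  - by move=> z; rewrite EP.
  - by move=> z; rewrite EP.
  - rewrite /b ler_pdivlMr; nra.
move=> /leq_trans/(_ (leq_mul (leqnn _) Eb)); rewrite muln1 -(ler_nat R).
move=> /le_trans; apply; rewrite natrX -exprMn lerXn2r ?nnegrE//; nra.
Qed.

Lemma size_le_translate_count (V : zmodType) (A B : seq V) (p : pred V) (z : V) :
  uniq A -> {in A, forall v, z + v \in B /\ p (z + v)} ->
  (size A <= count p B)%N.
Proof.
move=> uA zAB; rewrite -size_filter -(size_map (+%R z)).
apply: uniq_leq_size; first by rewrite map_inj_uniq//; exact: addrI.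
by move=> _ /mapP[v /zAB[zB pz] ->]; rewrite mem_filter pz.
Qed.

Lemma sphere_cover (R : realType) (X : normedModType R) (d : nat)
    (f : {additive 'rV[int]_d -> X}) (C c : R) :
  (0 < d)%N -> 0 < C -> (forall (z : 'rV[int]_d) i, `|z 0 i|%:~R <= C * `|f z|) ->
  (forall x, exists z, `|x - f z| <= c) ->
  exists2 W : seq X, (size W <= 4 * 5 ^ d * (52 * d * d))%N &
    exists2 r : R, 0 <= r < 4^-1 &
      forall u, `|u| = 1 -> exists2 w, w \in W & `|u - w| <= r.
Proof.
move=> d0 C0 fC fc.
have [E uE EP] := lattice_balls C0 fC.
have E0 s : 0 <= s -> (0 < size (E s))%N.
  by move=> s0; case: (E s) (EP s 0) => //; rewrite raddf0 normr0 s0.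
have d1 : 1 <= d%:R :> R by rewrite ler1n.
pose de : R := (24 * d%:R)^-1.
have de0 : 0 < de by rewrite invr_gt0; lra.
have ded : de * d%:R = 24^-1 by rewrite /de invfM mulfVK// gt_eqF//; lra.
have de1 : de <= 24^-1 by nra.
(* The term 3 [de] leaves room for the final radius r + 2 [de] < 1/4. *)
pose r : R := 4^-1 - 3 * de.
have r0 : 0 < r by rewrite /r; lra.
(* With s = t r this makes l s = 5/4 t. *)
pose l : R := 5 / 4 / r.
have lr : l * r = 5 / 4 by rewrite /l divfK// gt_eqF.
have l1 : 1 < l by rewrite /l ltr_pdivlMr// /r; lra.
have c0 : 0 <= c by have [z] := fc 0; exact: le_trans.
(* [c] bounds the covering radius of the lattice; for s >= [s0] it is at most [de] t. *)
pose s0 := 1 + c / de.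
have s00 : 1 <= s0 by rewrite /s0 lerDl divr_ge0// ltW.
have [|||s s0s grow] := @geometric_growth R (fun s => (size (E s))%:R) l s0
  ((4 * C + 1) ^+ d) d l1.
- by lra.
- by rewrite ltr0n E0//; lra.
- by move=> s s0s; apply: size_lattice_ball_le => //; lra.
have [t ts] : exists t, t * r = s by exists (s / r); rewrite divfK// gt_eqF.
have s1 : 1 <= s by lra.
have st : s <= t by rewrite -(ler_pM2r r0) ts ler_piMr /r; lra.
have ct : c <= de * t.
  rewrite -ler_pdivrMl// mulrC (le_trans _ st)// (le_trans _ s0s)// /s0; lra.
have t0 : 0 < t by lra.
have ld : l ^+ d <= 2 * 5 ^+ d.
  (* Bernoulli: (1 - 12 [de]) ^ d >= 1 - 12 [de] d = 1/2. As 4 r l = 5, this loses only a factor 2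
     in l ^ d. *)
  have : 2^-1 <= (4 * r) ^+ d.
    rewrite (_ : 4 * r = 1 - 12 * de); last by rewrite /r; field.
    have x01 : 0 <= 12 * de <= 1 by apply/andP; split; lra.
    have := bernoulli_ge d x01; rewrite -mulrA ded; lra.
  have : (4 * r) ^+ d * l ^+ d = 5 ^+ d.
    by rewrite -exprMn -mulrA [r * l]mulrC lr; congr (_ ^+ d); field.
  have : 0 < l ^+ d by rewrite exprn_gt0//; lra.
  nra.
pose q := (4 * 5 ^ d)%N.
have CE : (size (E (l * s)%R) <= q * size (E s))%N.
  rewrite -(ler_nat R) (le_trans grow)// natrM ler_wpM2r// natrM natrX.
  by lra.
have Es0 : (0 < size (E s))%N.
  by rewrite E0//; lra.
have YE : (size (E ((1 + 2 * de) * t)%R) <=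
    (52 * d) ^ d * size (E (de * t)%R))%N.
  apply: (scale_lattice_count (f := f) (a := (1 + 2 * de) * t) (b := de * t)) => //.
  - by rewrite muln_gt0.
  - by move=> z; rewrite EP.
  - by move=> z; rewrite EP.
  - by rewrite natrM !mulrA ler_pM2r//; nra.
have [|W Wn Wcov] := greedy_cover (e := fun y w => `|f y - f w| <= s)
  (Y := E ((1 + 2 * de) * t)) Es0 CE _ (q * (52 * d * d)).
  (* Translating [E s] by y gives admissible centres, since (1 + 2 [de]) t + s <= 5/4 t = l s. *)
  move=> y; rewrite EP => yE.
  apply: (size_le_translate_count (z := y)) => // v; rewrite !EP => vE.
  rewrite raddfD opprD addNKr normrN; split=> //.
  rewrite (le_trans (ler_normD _ _))//.
  have -> : l * s = 5 / 4 * t by rewrite -lr -ts; ring.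
  apply: le_trans (lerD yE vE) _; rewrite -ts /r; nra.
have Ufew : (count (fun y => ~~ has (fun w => (`|f y - f w| <= s)%R) W)
    (E ((1 + 2 * de) * t)%R) < size (E (de * t)%R))%N.
  have Et0 : (0 < size (E (de * t)%R))%N.
    by rewrite E0// mulr_ge0// ltW.
  have gs := greedy_steps d0; rewrite -/q in gs.
  have := leq_trans Wcov (leq_mul (leqnn _) YE).
  rewrite [leqRHS]mulnA => h.
  rewrite -(ltn_pmul2l (m := q ^ (q * (52 * d * d)))); last first.
    by apply: leq_ltn_trans gs.
  by rewrite (leq_ltn_trans h)// ltn_pmul2r.
exists [seq t^-1 *: f w | w <- W]; first by rewrite size_map.
exists (r + 2 * de); first by rewrite /r; lra.
move=> u u1; have [z zu] := fc (t *: u).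
have zt : `|f z| <= (1 + de) * t.
  rewrite -(subKr (t *: u) (f z)) (le_trans (ler_normB _ _))//.
  by rewrite normrZ u1 gtr0_norm//; lra.
(* The translates z + v with |f v| <= [de] t outnumber the uncovered points, so one of them is
   covered. *)
have [v] : exists v, `|f v| <= de * t /\ has (fun w => `|f (z + v) - f w| <= s) W.
  apply: contrapT => /forallNP noV; move: Ufew; rewrite ltnNge => /negP; apply.
  apply: (size_le_translate_count (z := z)) => // v; rewrite !EP => vE.
  split; last by apply/negP => h; exact: (noV v).
  by rewrite raddfD (le_trans (ler_normD _ _))//; lra.
move=> [vE /hasP[w wW vw]]; exists (t^-1 *: f w); first exact: map_f.
rewrite -(@ler_pM2l _ t)// -[X in X * `|_|]gtr0_norm// -normrZ scalerBr.
rewrite scalerA divff ?gt_eqF// scale1r.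
(* The three terms are at most [de] t, s = r t and [de] t. *)
rewrite (_ : _ - _ = (t *: u - f z) + (f (z + v) - f w) - f v); last first.
  rewrite raddfD -[f z + f v - f w]addrA -[t *: u - f z + _]addrA addKr.
  by rewrite [in RHS]addrCA [RHS]addrC addKr.
rewrite (le_trans (ler_normB _ _))// (le_trans (lerD (ler_normD _ _) (lexx _)))//.
rewrite -ts in vw; nra.
Qed.

(** * Lattices in finite-dimensional normed spaces *)

Lemma coord_le_mx_norm (R : realType) (d : nat) (v : 'rV[R]_d) i :
  `|v 0 i| <= `|v|.
Proof.
rewrite [leRHS]/Num.norm /= mx_normrE.
by apply/bigmax_geP; right; exists (0, i).
Qed.

Lemma linear_rV_bound (R : realType) (X : normedModType R) (d : nat)
    (g : {linear 'rV[R]_d -> X}) :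
  exists2 A, 0 <= A &
    forall (v : 'rV[R]_d) M, (forall i, `|v 0 i| <= M) -> `|g v| <= A * M.
Proof.
exists (\sum_(i < d) `|g (delta_mx 0 i)|); first exact: sumr_ge0.
move=> v M vM; rewrite {1}(row_sum_delta v) linear_sum mulr_suml.
apply: le_trans (ler_norm_sum _ _ _) _; apply: ler_sum => i _.
by rewrite linearZ normrZ mulrC ler_wpM2l.
Qed.

(** By compactness |g| attains a minimum on the unit sphere of the sup norm; it is positive by
    injectivity, and C is its inverse. *)
Lemma injective_linear_rV_coord_bound (R : realType) (X : normedModType R)
    (d : nat) (g : {linear 'rV[R]_d -> X}) :
  injective g ->
  exists2 C, 0 < C & forall (v : 'rV[R]_d) i, `|v 0 i| <= C * `|g v|.
Proof.
move=> ginj; pose S := [set v : 'rV[R]_d | `|v| = 1].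
have [A A0 gA] := linear_rV_bound g.
have gc : continuous g.
  apply/linear_bounded_continuous/linear_boundedP; exists A; split=> [|M AM v].
    exact: ger0_real.
  have gv := gA v `|v| (coord_le_mx_norm v).
  apply: le_trans gv _.
  by rewrite ler_wpM2r// ltW.
have [[u uS]|S0] := pselect (S !=set0); last first.
  (* An empty sphere means that every vector is 0. *)
  exists 1 => // v i.
  have -> : v = 0.
    apply: contra_notP S0 => /eqP v0; exists (`|v|^-1 *: v).
    by rewrite /S/= normrZ ger0_norm// mulVf// normr_eq0.
  by rewrite mxE normr0 mul1r.
have cS : compact S.
  apply: bounded_closed_compact.
    exists 1; split=> // M M1 v /=; rewrite /S/= => ->; exact: ltW.
  rewrite (_ : S = (fun v => `|v|) @^-1` [set 1]) //.
  apply: closed_comp => // v _; exact: norm_continuous.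
have [|w wS wmin] := @EVT_min_rV R d (fun v => `|g v|) S (ex_intro _ u uS) cS.
  apply: continuous_subspaceT => v.
  exact: (continuous_comp (gc v) (@norm_continuous _ _ _)).
have w0 : 0 < `|g w|.
  rewrite normr_gt0; apply: contraPneq (set_mem wS) => gw0; rewrite /S/=.
  have -> : w = 0 by apply: ginj; rewrite gw0 linear0.
  by rewrite normr0 => /eqP; rewrite eq_sym oner_eq0.
exists (`|g w|^-1); rewrite ?invr_gt0// => v i.
rewrite mulrC ler_pdivlMr//.
have [->|v0] := eqVneq v 0; first by rewrite mxE normr0 mul0r.
apply: (@le_trans _ _ (`|v| * `|g w|)); first by rewrite ler_wpM2r// coord_le_mx_norm.
have := wmin (`|v|^-1 *: v); rewrite linearZ normrZ ger0_norm//.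
rewrite ler_pdivlMl ?normr_gt0//; apply; apply: mem_set.
by rewrite /S/= normrZ ger0_norm// mulVf// normr_eq0.
Qed.

(** The lattice is the image of the integer vectors under a coordinate isomorphism; rounding
    coordinates down bounds its covering radius. *)
Lemma vector_axiom_lattice (R : realType) (X : normedModType R) (d : nat) :
  Vector.axiom d X ->
  exists f : {additive 'rV[int]_d -> X},
    (exists2 C, 0 < C & forall (z : 'rV[int]_d) i, `|z 0 i|%:~R <= C * `|f z|)
    /\ exists c, forall x, exists z, `|x - f z| <= c.
Proof.
move=> [v vlin [g vK gK]].
pose vL := GRing.isLinear.Build R X 'rV[R]_d *:%R v vlin.
pose vl : {linear X -> 'rV[R]_d} := HB.pack v vL.
have glin : linear g := can2_linear (f := vl) vK gK.
pose gL := GRing.isLinear.Build R 'rV[R]_d X *:%R g glin.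
pose gl : {linear 'rV[R]_d -> X} := HB.pack g gL.
pose f (z : 'rV[int]_d) : X := g (map_mx intr z).
have fadd : zmod_morphism f.
  by move=> y z; rewrite /f raddfB [LHS](raddfB gl).
pose fA := GRing.isZmodMorphism.Build 'rV[int]_d X f fadd.
pose fa : {additive 'rV[int]_d -> X} := HB.pack f fA.
exists fa; split.
  have [C C0 gC] := injective_linear_rV_coord_bound (g := gl) (can_inj gK).
  by exists C => // z i; have := gC (map_mx intr z) i; rewrite mxE -intr_norm.
have [A A0 gA] := linear_rV_bound gl.
exists (A * 1) => x; exists (\row_i Num.floor (v x 0 i)).
rewrite -{1}(vK x) -[X in `|X|](raddfB gl); apply: gA => i.
rewrite !mxE ger0_norm ?subr_ge0 ?floor_le//.
by have := floorD1_gt (v x 0 i); rewrite intrD; lra.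
Qed.

(** * From the cover to thin cones *)

Lemma thin_cones_of_sphere_cover (R : realType) (X : normedModType R)
    (W : seq X) (r : R) :
  0 <= r < 4^-1 -> (exists x : X, x != 0) ->
  (forall u, `|u| = 1 -> exists2 w, w \in W & `|u - w| <= r) ->
  exists F : set (set X),
    [/\ F #<= `I_(size W), (forall P, F P -> thin P) & separating F].
Proof.
move=> /andP[r0 r4] [x0 x00] Wr.
(* Balls with |w| < 1 - r miss the sphere and are dropped; the others have |w| >= 1 - r > 3 r, as r
   < 1/4. *)
pose F := [set P | exists w, [/\ w \in W, 1 - r <= `|w| & P = ball_cone r w]].
have FP P : F P -> thin P.
  by move=> [w [_ wr ->]]; apply: ball_cone_thin => //; lra.
exists F; split=> //.
  apply: card_le_trans (card_image_le (fun i => ball_cone r (nth 0 W i)) _).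
  apply: subset_card_le => P [w [wW _ ->]]; exists (index w W).
    by rewrite /= index_mem.
  by rewrite nth_index.
split; first by move=> P /FP[].
have cov x : x != 0 -> exists2 P, F P & P x.
  move=> x0'; have n0 : 0 < `|x| by rewrite normr_gt0.
  have u1 : `|(`|x|^-1 *: x)| = 1.
    by rewrite normrZ ger0_norm ?invr_ge0// mulVf// gt_eqF.
  have [w wW wr] := Wr _ u1; exists (ball_cone r w).
    exists w; split=> //; have := le_trans (lerB_dist _ _) wr; rewrite u1; lra.
  exists `|x| => //.
  rewrite -[X in `|X - _|]scale1r -[1](@divff _ `|x|) ?gt_eqF// -scalerA.
  by rewrite -scalerBr normrZ ger0_norm// ler_wpM2l.
apply/seteqP; split=> // x _.
have [->|/cov[P PF Px]] := eqVneq x 0; last by exists P => //; left.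
have [P PF _] := cov _ x00; exists P => //; left.
have [[[[y Py] _ sc] _] _] := FP _ PF.
by rewrite -(scale0r y); apply: sc.
Qed.

(** * Asymptotics of the number of cones *)

(** From exp y >= y ^ 4 / 4! at y = x ln a. At x = sqrt d it absorbs the factor d ^ 2 into 5 ^ (sqrt
    d). *)
Lemma fourth_power_le_powR (R : realType) (a x : R) :
  1 < a -> 0 <= x -> x ^+ 4 <= 24 / ln a ^+ 4 * a `^ x.
Proof.
move=> a1 x0; have la : 0 < ln a by rewrite ln_gt0.
have la4 : 0 < ln a ^+ 4 by rewrite exprn_gt0.
have := expR_ge1Dxn 3 (mulr_ge0 x0 (ltW la)).
rewrite -[expR _]/(expR (x * ln a)) exprMn /powR gt_eqF; last by lra.
have -> : 4`!%:R = 24 :> R by [].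
move=> h; rewrite mulrAC ler_pdivlMr//.
lra.
Qed.

Theorem corollary36 (R : realType) :
  exists (N : nat -> nat) (e : nat -> R),
    [/\ e =o_\oo (fun d : nat => d%:R : R),
        (fun d : nat => (N d)%:R : R) =O_\oo
          (fun d : nat => 5 `^ (d%:R + e d) : R)
      & forall (d : nat) (X : normedModType R),
          (0 < d)%N -> Vector.axiom d X ->
          exists F : set (set X),
            [/\ F #<= `I_(N d),
                (forall P, F P -> thin P)
              & separating F]].
Proof.
exists (fun d => 4 * 5 ^ d * (52 * d * d))%N, (fun d => Num.sqrt d%:R); split.
- apply/eqoP => eps eps0; near=> d.
  rewrite !ger0_norm ?sqrtr_ge0//.
  rewrite -{2}(sqr_sqrtr (ler0n R d)) expr2 mulrA ler_peMl ?sqrtr_ge0//.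
  rewrite -ler_pdivrMl// mulr1 -[leLHS]ger0_norm ?invr_ge0 ?(ltW eps0)//.
  rewrite -sqrtr_sqr; apply: ler_wsqrtr.
  near: d; exact: nbhs_infty_ger.
(* Here 208 = 4 * 52. *)
- apply/eqO_exP; exists (208 * (24 / ln 5 ^+ 4)).
    by rewrite mulr_gt0// divr_gt0// exprn_gt0// ln_gt0// ltr1n.
  near=> d; rewrite !ger0_norm ?powR_ge0// powRD ?pnatr_eq0 ?implybT// powR_mulrn//.
  have := @fourth_power_le_powR R 5 (Num.sqrt d%:R).
  rewrite ltr1n sqrtr_ge0 (exprM _ 2 2) sqr_sqrtr// => /(_ isT isT).
  have : 0 < 5 ^+ d :> R by rewrite exprn_gt0.
  rewrite !natrM natrX.
  nra.
- move=> d X d0 Xd; have [f [[C C0 fC] [c fc]]] := vector_axiom_lattice Xd.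
  have [W Wd [r r4 Wr]] := sphere_cover d0 C0 fC fc.
  have X0 : exists x : X, x != 0.
    exists (f (const_mx 1)); apply/negP => /eqP f0.
    have := fC (const_mx 1) (Ordinal d0).
    by rewrite f0 normr0 mulr0 mxE normr1 ler10.
  have [F [FW Fthin Fsep]] := thin_cones_of_sphere_cover r4 X0 Wr.
  exists F; split=> //; apply: card_le_trans FW _.
  by apply: subset_card_le => i /= /leq_trans; exact.
Unshelve. all: by end_near.
Qed.
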